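(* Let $b_nn\in\{1,\dots,n\}$ with $\lim_{n\to\infty}b_n=b\in[0,1]$, and let $E(b)\equiv\lim_{n\to\infty}\frac1nE^{p_n(\mathrm{id},\cdot)}\sigma^{-1}_{b_nn}$ denote the rescaled limiting expected position of card number $b_nn$ (the limit exists and depends only on $b$). Then $$E(b)=eb+\tfrac12e^{1-b}-e^b .$$ The function $E(b)$, $b\in[0,1]$, has the following properties: (i) $E(0)=\frac12e-1\approx.359$; (ii) $E(1)=\frac12$; (iii) $E(\cdot)$ increases for $b\in[0,b^*]$ and decreases for $b\in[b^*,1]$, where $b^*\approx.722$ is the solution in $[0,1]$ to $e-e^b-\frac12e^{1-b}=0$; the maximum value of $E(\cdot)$ is $E(b^* )\approx.564$; (iv) $E(b)\ge b$ for $b\in[0,\bar b]$ and $E(b)\le b$ for $b\in[\bar b,1]$, where $\bar b\approx.545$; (v) $\int_0^1E(b)\,db=\frac12$.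
   Context: A permutation $\sigma\in S_n$ is viewed as a deck of cards numbered $1,\dots,n$ laid out in a row, where $\sigma_j$ is the number of the card in the $j$-th position from the left; thus $\sigma^{-1}_i$ is the position of the card numbered $i$. The card-cyclic to random insertion shuffle removes each of the $n$ cards exactly once and immediately reinserts it in a position chosen uniformly from the $n$ possible positions (independently of the other insertions); the removals and reinsertions are performed one card at a time in the original left-to-right order of the cards. Starting from the identity $\mathrm{id}$ (cards in increasing order from left to right), the cards are thus removed and reinserted in the order $1,2,\dots,n$, and after card $j$ is reinserted in ''position $k$'' it is the $k$-th card from the left. $p_n(\mathrm{id},\cdot)$ denotes the distribution on $S_n$ of the deck after one such shuffle started from $\mathrm{id}$, and $E^{p_n(\mathrm{id},\cdot)}$ the corresponding expectation. The symbol $\approx$ indicates the numerical value to three decimal places. *)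

(* Defs.v *)
From HB Require Import structures.
From mathcomp Require Import all_boot all_order all_algebra all_fingroup.
From mathcomp Require Import all_classical all_reals all_analysis.
Set Implicit Arguments.
Unset Strict Implicit.
Unset Printing Implicit Defensive.
Import Order.TTheory GRing.Theory Num.Theory.
Import numFieldNormedType.Exports.
Local Open Scope ring_scope.

(* A deck of [n.+1] cards is a permutation [s : 'S_n.+1], [s j] being the card
   in position [j] and [s^-1 i] the position of card [i].  Cards and positions
   are 0-based: the ordinal [i] stands for the card (or position) numbered
   [i.+1].  *)

(* Since [(u * s) j = s (u j)] and [lift_perm k p 1] sends [k] to [p] and
   [lift k j] to [lift p j], this is the deck obtained from [s] by taking out
   card [i], which sits in position [s^-1 i], and putting it back so that it
   ends up in position [k], the other cards keeping their relative order.  *)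
Definition reinsert (n : nat) (s : 'S_n.+1) (i k : 'I_n.+1) : 'S_n.+1 :=
  (lift_perm k ((s^-1)%g i) 1 * s)%g.

Lemma reinsert_id (n : nat) (s : 'S_n.+1) (i k : 'I_n.+1) :
  reinsert s i k k = i.
Proof. by rewrite permM lift_perm_id permKV. Qed.

Lemma reinsert_lift (n : nat) (s : 'S_n.+1) (i k : 'I_n.+1) (j : 'I_n) :
  reinsert s i k (lift k j) = s (lift ((s^-1)%g i) j).
Proof. by rewrite permM lift_perm_lift perm1. Qed.

(* [w j] is the position chosen for the card that was in position [j] of the
   original deck [s]; [enum 'I_n.+1] is increasing, so the cards are treated in
   their original left-to-right order.  *)
Definition shuffle (n : nat) (s : 'S_n.+1) (w : {ffun 'I_n.+1 -> 'I_n.+1}) :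
    'S_n.+1 :=
  foldl (fun d j => reinsert d (s j) (w j)) s (enum 'I_n.+1).

(* Independent uniform insertion positions amount to the uniform distribution
   on the functions [w].  *)
Definition shuffle_kernel (R : realType) (n : nat) (s t : 'S_n.+1) : R :=
  #|[set w : {ffun 'I_n.+1 -> 'I_n.+1} | shuffle s w == t]|%:R
  / #|{ffun 'I_n.+1 -> 'I_n.+1}|%:R.

Definition shuffle_expectation (R : realType) (n : nat) (s : 'S_n.+1)
    (f : 'S_n.+1 -> R) : R :=
  \sum_(t : 'S_n.+1) shuffle_kernel R s t * f t.

Definition card_position (R : realType) (n : nat) (i : 'I_n.+1) (t : 'S_n.+1) : R :=
  ((t^-1)%g i).+1%:R.

(* [E] is the rescaled limiting expected position on [0, 1].  [b_] is indexed by
   the size of the deck, and [c n] is card number [b_ n.+1 * n.+1] of the deck of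
   [n.+1] cards (the deck without cards is left out).  *)
Definition is_limiting_position (R : realType) (E : R -> R) : Prop :=
  forall (b : R) (b_ : nat -> R) (c : forall n : nat, 'I_n.+1),
    b \in `[0, 1] ->
    (forall n : nat, b_ n.+1 * n.+1%:R = (c n).+1%:R) ->
    (b_ @ \oo --> b)%classic ->
    ((fun n : nat => n.+1%:R^-1 *
        shuffle_expectation (1%g : 'S_n.+1) (card_position R (c n)))
      @ \oo --> E b)%classic.

(* [m / 1000] is [x] rounded to three decimal places.  *)
Definition approx3 (R : realType) (x : R) (m : nat) : Prop :=
  `|x - m%:R / 1000%:R| < 1 / 2000%:R.

(* Main.v *)
(* Fix the card [i] in a deck of [N] cards and put [a = 1 + 1/N].  Averaging over
   the insertion position of a card [m <> i] turns the position of [i] into [a]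
   times its position in the deck without [m], and does not affect the relative
   order of the other cards.  So, going backwards in time, the mean of the final
   position of [i] given the deck is an affine combination of the position of
   [i] and of the indicators of "[j] is to the left of [i]" for the cards [j]
   still to be moved.  When [i] itself is inserted, the mean of such an indicator
   is affine in the position of [j], which is propagated back to the initial deck
   in the same way.  Geometric sums then give, for the card numbered [i], the mean
   position [a^(N-i) (N+1)/2 - N a^i + i a^N], whence the limit.  The properties
   of the limit [E] follow from [E'(b) e^b = (y - e^b) (e^b - (e - y))], where
   [e - y < 1 < y] are the roots of [p^2 - e p + e/2], from [E' < 1], and from
   Taylor bounds of [exp]. *)
Require Import Defs.
From HB Require Import structures.
From mathcomp Require Import all_boot all_order all_algebra all_fingroup.
From mathcomp Require Import all_classical all_reals all_analysis.
From mathcomp Require Import ring lra zify.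
Import Order.TTheory GRing.Theory Num.Theory.
Import numFieldNormedType.Exports.
Local Open Scope ring_scope.

(** * The mean position after one shuffle *)

Definition ffun_upd {aT rT : finType} (w : {ffun aT -> rT}) (j : aT) (k : rT) :
    {ffun aT -> rT} :=
  [ffun x => if x == j then k else w x].

(* The sum over [k] and [w] is reindexed along the involution that swaps [k]
   and [w j]. *)
Lemma sum_ffun_resample (V : zmodType) (aT rT : finType) (j : aT)
    (G : rT -> {ffun aT -> rT} -> V) :
  (forall k k' w, G k (ffun_upd w j k') = G k w) ->
  (\sum_(w : {ffun aT -> rT}) G (w j) w) *+ #|rT| =
  \sum_k \sum_(w : {ffun aT -> rT}) G k w.
Proof.
move=> Gj.
pose h (p : rT * {ffun aT -> rT}) := (p.2 j, ffun_upd p.2 j p.1).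
have hK : involutive h.
  case=> k w; rewrite /h /= ffunE eqxx; congr pair.
  by apply/ffunP => x; rewrite !ffunE; case: eqP => // ->.
rewrite pair_big /= (reindex_inj (inv_inj hK)) /=.
under [RHS]eq_bigr do rewrite Gj.
rewrite -(pair_big xpredT xpredT (fun _ (w : {ffun aT -> rT}) => G (w j) w)) /=.
by rewrite sumr_const.
Qed.

(** As [l] has no repetition, the steps after [j] never read [w j], so that coordinate can be
    resampled independently. The average over all [w] thus becomes a nest of one-step averages, the
    first step outermost. *)
Lemma sum_foldl_ffun (R : numFieldType) (aT rT : finType) (S : Type)
    (step : S -> aT -> rT -> S) (f : S -> R) (l : seq aT) (s : S) :
  (0 < #|rT|)%N -> uniq l ->
  \sum_(w : {ffun aT -> rT}) f (foldl (fun d j => step d j (w j)) s l) =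
  #|{ffun aT -> rT}|%:R *
  foldr (fun j g d => #|rT|%:R^-1 * \sum_k g (step d j k)) f l s.
Proof.
move=> rT0; elim: l s => [|j l IHl] s /=.
  by rewrite sumr_const mulr_natl.
case/andP=> jl ul.
have rTn0 : #|rT|%:R != 0 :> R by rewrite pnatr_eq0 -lt0n.
apply: (mulIf rTn0); rewrite mulr_natr.
rewrite (sum_ffun_resample _ _ _ j
  (fun k (w : {ffun aT -> rT}) =>
    f (foldl (fun d j => step d j (w j)) (step s j k) l))).
  rewrite (eq_bigr _ (fun k _ => IHl (step s j k) ul)).
  by rewrite -mulr_sumr -mulrA [_^-1 * _]mulrC divfK.
move=> k k' w; congr f.
move: jl; elim: l (step s j k) {ul IHl} => //= x l IHl d.
rewrite inE negb_or ffunE => /andP[jx jl].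
by rewrite eq_sym (negbTE jx) IHl.
Qed.

(** The Markov operator of a single reinsertion, acting on functions of the deck:
    [foldr insertion_mean f l] runs through the moves [l] backwards in time. *)
Definition insertion_mean {R : realType} {n : nat} (i : 'I_n.+1)
    (f : 'S_n.+1 -> R) : 'S_n.+1 -> R :=
  fun d => n.+1%:R^-1 * \sum_(k : 'I_n.+1) f (reinsert d i k).

(** The kernel counts the fibres of [shuffle 1], so the expectation is an average over all [w]; from
    the identity deck, step [j] moves card [j] itself. *)
Lemma shuffle_expectation_id (R : realType) (n : nat) (f : 'S_n.+1 -> R) :
  shuffle_expectation 1%g f = foldr insertion_mean f (enum 'I_n.+1) 1%g.
Proof.
have N0 : #|{ffun 'I_n.+1 -> 'I_n.+1}|%:R != 0 :> R.
  by rewrite pnatr_eq0 card_ffun card_ord -lt0n expn_gt0.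
apply: (mulfI N0); rewrite /insertion_mean.
have := @sum_foldl_ffun R _ _ _ (@reinsert n) f (enum 'I_n.+1) 1%g.
rewrite card_ord enum_uniq => <- //.
rewrite /shuffle_expectation mulr_sumr.
rewrite [RHS](partition_big (shuffle 1%g) xpredT) //=.
apply: eq_bigr => t _.
have shE (w : {ffun 'I_n.+1 -> 'I_n.+1}) :
    foldl (fun d j => reinsert d j (w j)) 1%g (enum 'I_n.+1) = shuffle 1%g w.
  congr (foldl _ _ _); apply/funext => d; apply/funext => j.
  by rewrite perm1.
under eq_bigr => w /eqP wt do rewrite shE wt.
rewrite sumr_const /shuffle_kernel mulrA mulrCA divff// mulr1 mulr_natl.
by congr (_ *+ _); apply: eq_card => w; rewrite !inE.
Qed.

Lemma insertion_mean_linear (R : realType) (n m : nat) (i : 'I_n.+1)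
    (a : R) (f : 'S_n.+1 -> R) (c : 'I_m -> R) (g : 'I_m -> 'S_n.+1 -> R) :
  insertion_mean i (fun d => a * f d - \sum_k c k * g k d) =
  (fun d => a * insertion_mean i f d - \sum_k c k * insertion_mean i (g k) d).
Proof.
apply/funext => d; rewrite /insertion_mean sumrB -mulr_sumr exchange_big /=.
rewrite mulrBr mulrCA; congr (_ - _); rewrite mulr_sumr.
by apply: eq_bigr => k _; rewrite -mulr_sumr mulrCA.
Qed.

Lemma insertion_mean_linear2 (R : realType) (n : nat) (i : 'I_n.+1)
    (a b : R) (f g : 'S_n.+1 -> R) :
  insertion_mean i (fun d => a * f d + b * g d) =
  (fun d => a * insertion_mean i f d + b * insertion_mean i g d).
Proof.
apply/funext => d; rewrite /insertion_mean big_split /= -!mulr_sumr; ring.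
Qed.

Lemma foldr_insertion_mean_linear2 (R : realType) (n : nat)
    (l : seq 'I_n.+1) (a b : R) (f g : 'S_n.+1 -> R) :
  foldr insertion_mean (fun d => a * f d + b * g d) l =
  (fun d => a * foldr insertion_mean f l d + b * foldr insertion_mean g l d).
Proof. by elim: l => //= i l ->; rewrite insertion_mean_linear2. Qed.

Lemma foldr_insertion_mean_linear (R : realType) (n m : nat) (l : seq 'I_n.+1)
    (a : R) (f : 'S_n.+1 -> R) (c : 'I_m -> R) (g : 'I_m -> 'S_n.+1 -> R) :
  foldr insertion_mean (fun d => a * f d - \sum_k c k * g k d) l =
  (fun d => a * foldr insertion_mean f l d -
    \sum_k c k * foldr insertion_mean (g k) l d).
Proof. by elim: l => //= i l ->; rewrite insertion_mean_linear. Qed.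

(** * Effect of one insertion on positions and relative order *)

Definition left_of {R : realType} {n : nat} (i j : 'I_n.+1) (d : 'S_n.+1) : R :=
  ((d^-1)%g i < (d^-1)%g j)%N%:R.

Lemma reinsert_inv (n : nat) (d : 'S_n.+1) (i k : 'I_n.+1) :
  ((reinsert d i k)^-1)%g i = k.
Proof. by apply: (perm_inj (s := reinsert d i k)); rewrite permKV reinsert_id. Qed.

(** Here [q] is the position of [j] in the deck without [i]. It does not depend on [k], and putting
    [i] back at [k] shifts it by [lift k]. *)
Lemma reinsert_inv_neq (R : realType) (n : nat) (d : 'S_n.+1)
    (i j : 'I_n.+1) : j != i ->
  exists q : 'I_n, [/\ (d^-1)%g j = lift ((d^-1)%g i) q,
    (forall k, ((reinsert d i k)^-1)%g j = lift k q) &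
    card_position R j d - left_of i j d = q.+1%:R].
Proof.
move=> ji.
have [|q dj _] := unlift_some (h := (d^-1)%g i) (i := (d^-1)%g j).
  by apply: contra_neq ji => /perm_inj.
exists q; split=> // [k|].
  apply: (perm_inj (s := reinsert d i k)).
  by rewrite permKV reinsert_lift -dj permKV.
rewrite /card_position /left_of dj /= /bump.
set p := nat_of_ord _.
have -> : (p < (p <= q) + q)%N = (p <= q)%N by apply/idP/idP; lia.
by rewrite -addnS natrD; ring.
Qed.

Lemma insertion_mean_cst (R : realType) (n : nat) (i : 'I_n.+1) (c : R) :
  insertion_mean i (fun=> c) = fun=> c.
Proof.
apply/funext => d.
rewrite /insertion_mean sumr_const card_ord -[c *+ _]mulr_natl.
by rewrite mulrA mulVf ?mul1r// pnatr_eq0.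
Qed.


Lemma foldr_insertion_mean_cst (R : realType) (n : nat) (l : seq 'I_n.+1)
    (c : R) : foldr insertion_mean (fun=> c) l = fun=> c.
Proof. by elim: l => //= i l ->; rewrite insertion_mean_cst. Qed.

(** Both positions are lifts, at the same point, of positions in the deck without [i], and lifting
    preserves order. *)
Lemma insertion_mean_left_of (R : realType) (n : nat) (i j j' : 'I_n.+1) :
  j != i -> j' != i ->
  insertion_mean i (@left_of R n j j') = left_of j j'.
Proof.
move=> ji j'i; apply/funext => d.
have [q [dj rj _]] := @reinsert_inv_neq R n d i j ji.
have [q' [dj' rj' _]] := @reinsert_inv_neq R n d i j' j'i.
have lj k : @left_of R n j j' (reinsert d i k) = (q < q')%N%:R.
  rewrite /left_of rj rj' /= /bump; congr (nat_of_bool _)%:R.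
  by apply/idP/idP; lia.
rewrite /insertion_mean; under eq_bigr do rewrite lj.
rewrite -[LHS]/(insertion_mean i (fun=> (q < q')%N%:R) d) insertion_mean_cst.
rewrite /left_of dj dj' /= /bump; congr (nat_of_bool _)%:R.
by apply/idP/idP; lia.
Qed.

Lemma foldr_insertion_mean_left_of (R : realType) (n : nat)
    (l : seq 'I_n.+1) (j j' : 'I_n.+1) : j \notin l -> j' \notin l ->
  foldr insertion_mean (@left_of R n j j') l = left_of j j'.
Proof.
elim: l => //= i l IHl; rewrite !inE !negb_or => /andP[ji jl] /andP[j'i j'l].
by rewrite IHl// insertion_mean_left_of.
Qed.

(** Counts the insertion positions [k] that push a card at reduced position [q] to the right. *)
Lemma sum_leq_ord (n : nat) (q : 'I_n) :
  (\sum_(k < n.+1) (k <= q) = q.+1)%N.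
Proof.
rewrite -[RHS]card_ord -sum1_card (big_ord_widen n.+1 (fun=> 1%N)); last first.
  by rewrite ltnS ltnW.
by rewrite [RHS]big_mkcond; apply: eq_bigr => k _; rewrite ltnS; case: leqP.
Qed.

(** Card [j] has 1-based reduced position [q.+1] and is pushed right with probability [q.+1 / n.+1],
    hence the factor [1 + 1 / n.+1]. *)
Lemma insertion_mean_card_position_neq (R : realType) (n : nat)
    (i j : 'I_n.+1) : j != i ->
  insertion_mean i (card_position R j) =
  fun d => (1 + n.+1%:R^-1) * (card_position R j d - left_of i j d).
Proof.
move=> ji; apply/funext => d.
have [q [_ rj ->]] := @reinsert_inv_neq R n d i j ji.
rewrite /insertion_mean /card_position.
have -> : \sum_(k < n.+1) (((reinsert d i k)^-1)%g j).+1%:R =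
    (\sum_(k < n.+1) ((k <= q)%N + q.+1))%N%:R :> R.
  rewrite natr_sum; apply: eq_bigr => k _.
  by rewrite rj /= /bump addnS.
rewrite big_split /= sum_nat_const card_ord sum_leq_ord natrD natrM; field.
by rewrite addrC natr1 pnatr_eq0.
Qed.

Lemma insertion_mean_card_position (R : realType) (n : nat) (i : 'I_n.+1) :
  insertion_mean i (card_position R i) = fun=> n.+2%:R / 2.
Proof.
apply/funext => d; rewrite /insertion_mean /card_position.
under eq_bigr do rewrite reinsert_inv.
have -> (m : nat) : \sum_(k < m) k.+1%:R = m%:R * m.+1%:R / 2 :> R.
  elim: m => [|m IHm]; first by rewrite big_ord0 !mul0r.
  by rewrite big_ord_recr /= IHm -!natr1; field.
by rewrite -!mulrA mulKf// pnatr_eq0.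
Qed.

(** Card [j] ends to the left of [i] exactly when [q < k]. The coefficients [1] and [- 1] are kept
    so that the right side matches [insertion_mean_linear2]. *)
Lemma insertion_mean_left_of_card (R : realType) (n : nat) (i j : 'I_n.+1) :
  j != i ->
  insertion_mean i (left_of j i) =
  fun d => 1 * 1 +
    - n.+1%:R^-1 * (1 * card_position R j d + - 1 * left_of i j d).
Proof.
move=> ji; apply/funext => d.
have [q [_ rj qE]] := @reinsert_inv_neq R n d i j ji.
rewrite !mul1r mulN1r qE /insertion_mean /left_of.
have -> : \sum_(k < n.+1) (((reinsert d i k)^-1)%g j <
    ((reinsert d i k)^-1)%g i)%N%:R = n.+1%:R - q.+1%:R :> R.
  have NE : n.+1%:R = \sum_(k < n.+1) 1 :> R by rewrite sumr_const card_ord.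
  apply: (canRL (addrK _)).
  rewrite -(sum_leq_ord n q) NE natr_sum -big_split; apply: eq_bigr => k _ /=.
  rewrite rj reinsert_inv /= /bump -natrD -[RHS]/1%:R; congr (_%:R).
  by case: leqP; case: leqP; lia.
by field; rewrite addrC natr1 pnatr_eq0.
Qed.

(** The indicator of the card of index [k] in [l] gets one factor [a] from its own move and one from
    each later move. Earlier moves leave it unchanged, as they concern other cards. *)
Lemma foldr_insertion_mean_card_position (R : realType) (n : nat)
    (l : seq 'I_n.+1) (i : 'I_n.+1) : uniq l -> i \notin l ->
  foldr insertion_mean (card_position R i) l =
  fun d => (1 + n.+1%:R^-1) ^+ size l * card_position R i d -
    \sum_(k < size l) (1 + n.+1%:R^-1) ^+ (size l - k) *
      left_of (nth i l k) i d.
Proof.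
set a := 1 + _.
elim: l => [|j l IHl] /=.
  by move=> _ _; apply/funext => d; rewrite big_ord0 mul1r subr0.
case/andP=> jl ul; rewrite inE negb_or => /andP[ij il].
rewrite IHl// insertion_mean_linear insertion_mean_card_position_neq//.
apply/funext => d; rewrite big_ord_recl /= subn0 exprS -/a.
rewrite (eq_bigr (fun k : 'I_(size l) =>
  a ^+ (size l - k) * left_of (nth i l k) i d)); first by ring.
move=> k _; rewrite insertion_mean_left_of//.
by apply: contraNneq jl => <-; rewrite mem_nth.
Qed.

(** Geometric sum, the prefactor [n.+2] being [a / (a - 1)]. *)
Lemma sum_insertion_powers (R : realType) (n m : nat) :
  let a : R := 1 + n.+1%:R^-1 in
  \sum_(k < m) a ^+ (m - k) = n.+2%:R * (a ^+ m - 1).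
Proof.
move=> a; elim: m => [|m IHm]; first by rewrite big_ord0 subrr mulr0.
rewrite big_ord_recl subn0 (eq_bigr (fun k : 'I_m => a ^+ (m - k))) ?IHm//.
rewrite exprS /a -[n.+2%:R]natr1; field.
by rewrite addrC natr1 pnatr_eq0.
Qed.

Lemma sum_weighted_insertion_powers (R : realType) (n m : nat) :
  let a : R := 1 + n.+1%:R^-1 in
  \sum_(k < m) (m - k)%:R * a ^+ (m - k) =
  n.+2%:R * (n.+1%:R - a ^+ m * (n.+1%:R - m%:R)).
Proof.
move=> a; elim: m => [|m IHm].
  by rewrite big_ord0 subr0 mul1r subrr mulr0.
rewrite big_ord_recl subn0.
rewrite (eq_bigr (fun k : 'I_m => (m - k)%:R * a ^+ (m - k))) ?IHm//.
rewrite exprS /a -[n.+2%:R]natr1 -[m.+1%:R]natr1; field.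
by rewrite addrC natr1 pnatr_eq0.
Qed.

(** In the identity deck the first [i] cards all lie to the left of [j], so every indicator is 1 and
    a geometric sum remains. *)
Lemma foldr_insertion_mean_card_position_id (R : realType) (n : nat)
    (i j : 'I_n.+1) : (i <= j)%N ->
  foldr insertion_mean (card_position R j) (take i (enum 'I_n.+1)) 1%g =
  n.+2%:R - (1 + n.+1%:R^-1) ^+ i * (n.+1%:R - j%:R).
Proof.
move=> ij; have si : size (take i (enum 'I_n.+1)) = i.
  by rewrite size_takel// size_enum_ord ltnW.
have nthi k : (k < i)%N -> nth j (take i (enum 'I_n.+1)) k = k :> nat.
  by move=> ki; rewrite nth_take// nth_enum_ord// (ltn_trans ki).
rewrite foldr_insertion_mean_card_position.
- rewrite si (eq_bigr (fun k : 'I_i => (1 + n.+1%:R^-1) ^+ (i - k))).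
    rewrite sum_insertion_powers /card_position invg1 perm1.
    by rewrite -[j.+1%:R]natr1 -[n.+2%:R]natr1; ring.
  move=> k _; rewrite /left_of invg1 !perm1 nthi//.
  by rewrite (leq_trans (ltn_ord k) ij) mulr1.
- by rewrite take_uniq// enum_uniq.
- apply/negP => /(nthP j)[k]; rewrite si => ki /(congr1 val)/=.
  by rewrite nthi// => kj; move: ki ij; rewrite kj; case: leqP.
Qed.

Lemma expected_card_position (R : realType) (n : nat) (i : 'I_n.+1) :
  let a : R := 1 + n.+1%:R^-1 in
  shuffle_expectation 1%g (card_position R i) =
  a ^+ (n - i) * (n.+2%:R / 2) - n.+1%:R * a ^+ i.+1 + i.+1%:R * a ^+ n.+1.
Proof.
move=> a; rewrite shuffle_expectation_id.
pose e := enum 'I_n.+1.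
have se : size e = n.+1 by rewrite size_enum_ord.
(* The moves split into those before, of and after card [i]; backwards in time, the last group comes
   first. *)
have eE : e = take i e ++ i :: drop i.+1 e.
  rewrite -{1}(cat_take_drop i e) (drop_nth i) ?se//; congr (_ ++ _ :: _).
  by apply: val_inj; rewrite /= nth_enum_ord.
have ue := enum_uniq 'I_n.+1; rewrite -/e in ue *.
have := ue; rewrite eE cat_uniq /= => /and4P[_ h1 id ud].
have [it hd] := norP h1.
have sd : size (drop i.+1 e) = (n - i)%N by rewrite size_drop se subSS.
have nthd k : (k < n - i)%N -> nth i (drop i.+1 e) k = (i.+1 + k)%N :> nat.
  by move=> ki; rewrite nth_drop nth_enum_ord//; lia.
rewrite foldr_cat /= foldr_insertion_mean_card_position// sd -/a.
rewrite insertion_mean_linear insertion_mean_card_position.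
rewrite foldr_insertion_mean_linear foldr_insertion_mean_cst.
(* Just after [i] is inserted, the 0-based card [j = i.+1 + k] is to its left with probability
   [a ^+ i * (n.+1 - j) / n.+1]; note that [n.+1 - j = n - i - k]. *)
rewrite (eq_bigr (fun k : 'I_(n - i) =>
   (a ^+ i / n.+1%:R) * ((n - i - k)%:R * a ^+ (n - i - k)))); last first.
  move=> k _; set j := nth _ _ _.
  have jE : j = (i.+1 + k)%N :> nat by rewrite nthd.
  have ji : j != i by rewrite -val_eqE /= jE; lia.
  have jt : j \notin take i e.
    by apply: (hasPn hd); rewrite mem_nth ?sd.
  rewrite insertion_mean_left_of_card//.
  rewrite !foldr_insertion_mean_linear2 foldr_insertion_mean_cst.
  rewrite foldr_insertion_mean_left_of//.
  rewrite foldr_insertion_mean_card_position_id ?jE; last by lia.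
  rewrite /left_of invg1 !perm1 jE -/a.
  have -> : (i < i.+1 + k)%N = true by lia.
  have -> : (n - i - k)%:R = n.+1%:R - (i.+1 + k)%:R :> R.
    rewrite -natrB; last by have := ltn_ord k; lia.
    by congr _%:R; lia.
  rewrite -[n.+2%:R]natr1 [nat_of_bool true]/=; field.
  by rewrite addrC natr1 pnatr_eq0.
rewrite -mulr_sumr sum_weighted_insertion_powers -/a natrB; last first.
  by rewrite -ltnS.
have -> : a ^+ n.+1 = a ^+ i.+1 * a ^+ (n - i).
  by rewrite -exprD; congr (_ ^+ _); have := ltn_ord i; lia.
have -> : a ^+ i.+1 = n.+2%:R / n.+1%:R * a ^+ i.
  rewrite exprS /a -[n.+2%:R]natr1; field.
  by rewrite addrC natr1 pnatr_eq0.
field.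
by rewrite addrC natr1 pnatr_eq0.
Qed.

(** * The limit *)

Definition limit_position {R : realType} (b : R) : R :=
  expR 1 * b + 1 / 2 * expR (1 - b) - expR b.

(** This is [ln (1 + t) <= t] at [t = - x / (1 + x)], where [1 + t] is the inverse of [1 + x]. *)
Lemma le_x_ln1Dx (R : realType) (x : R) : 0 <= x -> x / (1 + x) <= ln (1 + x).
Proof.
move=> x0; have x1 : 0 < 1 + x by lra.
have := @le_ln1Dx R (- (x / (1 + x))).
have -> : 1 + - (x / (1 + x)) = (1 + x)^-1.
  by field; rewrite lt0r_neq0.
rewrite lnV ?posrE// lerN2; apply.
by rewrite ltrN2 ltr_pdivrMr// mul1r; lra.
Qed.

Lemma cvg_mulr_ln1Dinvr (R : realType) :
  ((fun n => n.+1%:R * ln (1 + n.+1%:R^-1) : R) @ \oo --> (1 : R))%classic.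
Proof.
have h0 := @cvg_harmonic R.
have h1 : ((fun n => (1 + n.+1%:R^-1)^-1 : R) @ \oo --> (1 : R))%classic.
  rewrite -[X in (_ --> X)%classic]invr1; apply: cvgV => //.
  rewrite -[X in (_ --> X)%classic]addr0.
  by apply: cvgD; [exact: cvg_cst|exact: h0].
apply: (squeeze_cvgr _ h1 (@cvg_cst _ _ _ _ _)); apply: nearW => n.
have n0 : 0 < n.+1%:R :> R by rewrite ltr0n.
have i0 : 0 < n.+1%:R^-1 :> R by rewrite invr_gt0.
apply/andP; split; first by rewrite -ler_pdivrMl// le_x_ln1Dx// ltW.
rewrite -ler_pdivlMl// mulr1.
by apply: le_ln1Dx; apply: lt_trans i0; rewrite oppr_lt0.
Qed.

Lemma limit_position_is_limiting (R : realType) :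
  is_limiting_position (@limit_position R).
Proof.
move=> b b_ c _ bc b_b.
pose u n : R := n.+1%:R * ln (1 + n.+1%:R^-1).
have uu : (u @ \oo --> (1 : R))%classic := @cvg_mulr_ln1Dinvr R.
have bS : ((fun n => b_ n.+1) @ \oo --> b)%classic.
  by rewrite (cvg_shiftS b_).
have eu : ((fun n => expR (u n)) @ \oo --> expR 1)%classic.
  by apply: continuous_cvg => //; exact: continuous_expR.
have eb : ((fun n => expR (b_ n.+1 * u n)) @ \oo --> expR b)%classic.
  rewrite -[X in (_ --> expR X)%classic]mulr1.
  apply: continuous_cvg; first exact: continuous_expR.
  exact: cvgM.
have e1b : ((fun n => expR (u n - b_ n.+1 * u n)) @ \oo --> expR (1 - b))%classic.
  rewrite -[X in (_ --> expR (_ - X))%classic]mulr1.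
  apply: continuous_cvg; first exact: continuous_expR.
  by apply: cvgB => //; exact: cvgM.
have h1 : ((fun n => (1 + n.+1%:R^-1) * (1 / 2) : R) @ \oo --> (1 / 2 : R))%classic.
  rewrite -[X in (_ --> X)%classic]mul1r; apply: cvgM; last exact: cvg_cst.
  rewrite -[X in (_ --> X)%classic]addr0.
  by apply: cvgD; [exact: cvg_cst|exact: cvg_harmonic].
rewrite /limit_position addrAC.
(* With [N = n.+1], a power [(1 + 1/N) ^+ m] is [expR (m / N * u n)]; the ratios [m / N] that occur
   are [1], [b_ N] and [1 - b_ N]. *)
have fE n : n.+1%:R^-1 * shuffle_expectation 1%g (card_position R (c n)) =
    expR (u n) * b_ n.+1 - expR (b_ n.+1 * u n) +
    (1 + n.+1%:R^-1) * (1 / 2) * expR (u n - b_ n.+1 * u n).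
  rewrite expected_card_position.
  have n0 : n.+1%:R != 0 :> R by rewrite pnatr_eq0.
  have ap : 0 < 1 + n.+1%:R^-1 :> R by rewrite ltr_wpDr// invr_ge0 ler0n.
  have powE m : (1 + n.+1%:R^-1) ^+ m = expR (m%:R * ln (1 + n.+1%:R^-1)) :> R.
    by rewrite expRM_natl lnK.
  have -> : (1 + n.+1%:R^-1) ^+ (n - c n) = expR (u n - b_ n.+1 * u n) :> R.
    rewrite powE /u mulrA bc -mulrBl -natrB ?ltn_ord//.
  rewrite !powE -bc -/(u n) -mulrA -/(u n).
  rewrite -[n.+2%:R]natr1 /=; field.
  by rewrite addrC natr1.
rewrite (funext fE).
by apply: cvgD; [apply: cvgB => //; exact: cvgM|exact: cvgM].
Qed.

(** * Numerical bounds of the exponential *)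

Lemma expR_taylor_ge (R : realType) (m : nat) (x : R) : 0 <= x ->
  series (exp_coeff x) m <= expR x.
Proof.
move=> x0; apply: nondecreasing_cvgn_le; last exact: is_cvg_series_exp_coeff.
apply/nondecreasing_seqP => n.
by rewrite /series /= big_nat_recr//= lerDl divr_ge0 ?exprn_ge0 ?ler0n.
Qed.

(* The bound with [x ^ n / n!] added decreases in [n], because the next term of
   the series is at most half the previous one. *)
Lemma expR_taylor_le (R : realType) (m : nat) (x : R) :
  0 <= x -> x <= 1 -> (0 < m)%N ->
  expR x <= series (exp_coeff x) m + 2 * exp_coeff x m.
Proof.
move=> x0 x1 m0; apply: limr_le; first exact: is_cvg_series_exp_coeff.
exists m => // n /= mn.
suff : series (exp_coeff x) n + 2 * exp_coeff x n <=
       series (exp_coeff x) m + 2 * exp_coeff x m.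
  apply: le_trans; rewrite lerDl /exp_coeff /=.
  by rewrite mulr_ge0// divr_ge0 ?exprn_ge0 ?ler0n.
elim: n mn => [|n IHn]; first by rewrite leqn0 => /eqP->.
rewrite leq_eqVlt => /predU1P[->//|]; rewrite ltnS => mn.
apply: le_trans (IHn mn).
rewrite /series /exp_coeff /= big_nat_recr//= -addrA lerD2l.
rewrite exprS factS natrM invfM mulrACA.
have q0 : 0 <= x ^+ n / n`!%:R by rewrite divr_ge0 ?exprn_ge0 ?ler0n.
have : 2 * (x / n.+1%:R) <= 1.
  have n1 : 1 <= n%:R :> R by rewrite ler1n (leq_trans m0 mn).
  rewrite mulrA ler_pdivrMr ?ltr0n// -natr1; lra.
move: (x / _) (x ^+ n / _) q0 => t q q0 /(ler_wpM2r q0); lra.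
Qed.

(** Horner form of the Taylor polynomial of degree 9. *)
Definition expR_taylor {R : realType} (x : R) : R :=
  1 + x * (1 + x / 2 * (1 + x / 3 * (1 + x / 4 * (1 + x / 5 * (1 + x / 6 *
    (1 + x / 7 * (1 + x / 8 * (1 + x / 9)))))))).

Lemma expR_taylor_bounds (R : realType) (x : R) : 0 <= x -> x <= 1 ->
  expR_taylor x <= expR x <= expR_taylor x + x ^+ 10 / (1800 * 1000).
Proof.
move=> x0 x1.
have sE : series (exp_coeff x) 10 = expR_taylor x.
  rewrite /series /= /exp_coeff /=.
  rewrite !big_nat_recr//= big_geq// !factS fact0 !natrM /expR_taylor.
  by field.
have rE : 2 * exp_coeff x 10 <= x ^+ 10 / (1800 * 1000).
  (* [10! / 2 = 1814400], then weakened to [1800 * 1000]. *)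
  have -> : 2 * exp_coeff x 10 = x ^+ 10 / (18144 * 100).
    by rewrite /exp_coeff /= !factS fact0 !natrM; field.
  by have := exprn_ge0 10 x0; lra.
rewrite -sE; apply/andP; split; first exact: expR_taylor_ge.
have h := @expR_taylor_le R 10 x x0 x1 isT.
apply: (le_trans h).
rewrite lerD2l.
exact: rE.
Qed.

(** The bounds are 2.71828 and 2.71829, written by blocks of two decimals like the constants
    below. *)
Lemma expR1_bounds (R : realType) :
  2 + 71 / 100 + 82 / 100 ^+ 2 + 80 / 100 ^+ 3 <= (expR 1 : R) <=
  2 + 71 / 100 + 82 / 100 ^+ 2 + 90 / 100 ^+ 3.
Proof.
have /andP[] := @expR_taylor_bounds R 1 ler01 (lexx 1).
rewrite /expR_taylor expr1n => h1 h2; lra.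
Qed.

(* [.7216 < b* < .72166] and [.5445 < bbar < .5455]. *)
Lemma expR_7216_le (R : realType) :
  expR (72 / 100 + 16 / 100 ^+ 2) <= 2 + 5 / 100 + 77 / 100 ^+ 2 + 30 / 100 ^+ 3 :> R.
Proof.
have := @expR_taylor_bounds R (72 / 100 + 16 / 100 ^+ 2) ltac:(lra) ltac:(lra).
by rewrite /expR_taylor => /andP[h1 h2]; lra.
Qed.

Lemma expR_72166_ge (R : realType) :
  2 + 5 / 100 + 78 / 100 ^+ 2 + 40 / 100 ^+ 3 <= expR (72 / 100 + 16 / 100 ^+ 2 + 60 / 100 ^+ 3) :> R.
Proof.
have := @expR_taylor_bounds R (72 / 100 + 16 / 100 ^+ 2 + 60 / 100 ^+ 3) ltac:(lra) ltac:(lra).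
by rewrite /expR_taylor => /andP[h1 h2]; lra.
Qed.

Lemma expR_5445_le (R : realType) :
  expR (54 / 100 + 45 / 100 ^+ 2) <= 1 + 72 / 100 + 37 / 100 ^+ 2 + 50 / 100 ^+ 3 :> R.
Proof.
have := @expR_taylor_bounds R (54 / 100 + 45 / 100 ^+ 2) ltac:(lra) ltac:(lra).
by rewrite /expR_taylor => /andP[h1 h2]; lra.
Qed.

Lemma expR_5455_ge (R : realType) :
  1 + 72 / 100 + 54 / 100 ^+ 2 + 70 / 100 ^+ 3 <= expR (54 / 100 + 55 / 100 ^+ 2) :> R.
Proof.
have := @expR_taylor_bounds R (54 / 100 + 55 / 100 ^+ 2) ltac:(lra) ltac:(lra).
by rewrite /expR_taylor => /andP[h1 h2]; lra.
Qed.

(** * Shape of the limit *)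

Definition limit_position_deriv {R : realType} (b : R) : R :=
  expR 1 - 1 / 2 * expR (1 - b) - expR b.

Global Instance is_derive_limit_position (R : realType) (b : R) :
  is_derive b 1 limit_position (limit_position_deriv b).
Proof.
rewrite /limit_position; apply: is_derive_eq.
rewrite /limit_position_deriv /GRing.scale /= !mulr1.
ring.
Qed.

Lemma limit_position_continuous (R : realType) (a b : R) :
  {within `[a, b], continuous (@limit_position R)}%classic.
Proof. by apply: derivable_within_continuous => x _; exact: ex_derive. Qed.

Lemma limit_position_MVT (R : realType) (x y : R) : x < y ->
  exists2 z, x < z < y &
    limit_position y - limit_position x = limit_position_deriv z * (y - x).
Proof.
move=> xy.
have [z zxy E] := MVT xy (fun z _ => is_derive_limit_position R z)
  (limit_position_continuous R x y).
by exists z => //; move: zxy; rewrite in_itv.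
Qed.

Lemma expR_1B (R : realType) (b : R) : expR (1 - b) * expR b = expR 1.
Proof. by rewrite -expRD subrK. Qed.

Lemma limit_position_deriv_lt1 (R : realType) (b : R) :
  limit_position_deriv b < 1.
Proof.
have /andP[e1 e2] := expR1_bounds R.
have := expR_1B R b; rewrite /limit_position_deriv.
have := expR_gt0 b; have := expR_gt0 (1 - b).
move: (expR (1 - b)) (expR b) (expR 1) e1 e2 => q p e e1 e2 q0 p0 qp.
(* AM-GM for [p + q / 2]; its square is at least [2 e], and [2 e > (e - 1) ^ 2]. *)
rewrite ltNge; apply/negP => h.
have h1 : (p + q / 2) ^+ 2 <= (e - 1) ^+ 2.
  by rewrite ler_pXn2r ?nnegrE//; lra.
have h2 : 0 <= (p - q / 2) ^+ 2 by exact: sqr_ge0.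
(* Bounds [e ^+ 2] above by an affine function of [e]. *)
have h3 : 0 <= (e - 2718 / 1000) * (272 / 100 - e) by apply: mulr_ge0; lra.
rewrite -qp in e1 e2 h1 h3; nra.
Qed.

(** A derivative below 1 makes [limit_position x - x] nonincreasing, so a single zero settles both
    inequalities of (iv). *)
Lemma limit_position_sub_id_le (R : realType) (x y : R) : x <= y ->
  limit_position y - y <= limit_position x - x.
Proof.
rewrite le_eqVlt => /predU1P[->//|xy].
have [z _ E] := limit_position_MVT _ _ _ xy.
have h : limit_position_deriv z * (y - x) <= 1 * (y - x).
  by rewrite ler_wpM2r ?subr_ge0 ?ltW ?limit_position_deriv_lt1.
lra.
Qed.

Lemma approx3I (R : realType) (x : R) (m : nat) :
  m%:R - 1 / 2 < x * 10 ^+ 3 < m%:R + 1 / 2 -> approx3 x m.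
Proof.
rewrite /approx3 (_ : 1000%:R = 10 ^+ 3) -?natrX//.
rewrite (_ : 2000%:R = 2 * 10 ^+ 3) -?natrX -?natrM// natrM natrX.
by move=> /andP[h1 h2]; rewrite ltr_norml; apply/andP; split; lra.
Qed.

Lemma limit_position_gt_id (R : realType) (b : R) :
  b = 54 / 100 + 45 / 100 ^+ 2 -> b < limit_position b.
Proof.
have /andP[e1 e2] := expR1_bounds R; move=> bE; rewrite /limit_position.
have := expR_5445_le R; have := expR_1B R b; rewrite -bE.
have := expR_gt0 (1 - b); have := expR_gt0 b.
move: (expR (1 - b)) (expR b) (expR 1) e1 e2 => q p e e1 e2 p0 q0 qp ph.
(* From [q * p = e]: [1.72375 * 1.5768 < 2.71828]. *)
have : 1 + 57 / 100 + 68 / 100 ^+ 2 <= q by nra.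
by rewrite bE; lra.
Qed.

Lemma limit_position_lt_id (R : realType) (b : R) :
  b = 54 / 100 + 55 / 100 ^+ 2 -> limit_position b < b.
Proof.
have /andP[e1 e2] := expR1_bounds R; move=> bE; rewrite /limit_position.
have := expR_5455_ge R; have := expR_1B R b; rewrite -bE.
have := expR_gt0 (1 - b); have := expR_gt0 b.
move: (expR (1 - b)) (expR b) (expR 1) e1 e2 => q p e e1 e2 p0 q0 qp ph.
have : q <= 1 + 57 / 100 + 56 / 100 ^+ 2 by nra.
by rewrite bE; lra.
Qed.

Lemma limit_position_fixpoint (R : realType) :
  exists bbar : R,
    [/\ bbar \in `[0, 1],
        approx3 bbar 545,
        (forall b : R, b \in `[0, bbar] -> b <= limit_position b) &
        (forall b : R, b \in `[bbar, 1] -> limit_position b <= b)].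
Proof.
pose f (b : R) := limit_position b - b.
pose lo : R := 54 / 100 + 45 / 100 ^+ 2; pose hi : R := 54 / 100 + 55 / 100 ^+ 2.
have := limit_position_gt_id R lo erefl; rewrite -subr_gt0 -/(f lo) => flo.
have := limit_position_lt_id R hi erefl; rewrite -subr_lt0 -/(f hi) => fhi.
have lohi : lo <= hi by rewrite /lo /hi; lra.
have [||bbar] := @IVT R f lo hi 0 lohi.
- by apply: derivable_within_continuous => x _; exact: ex_derive.
- by rewrite ge_min le_max (ltW flo) (ltW fhi) orbT.
rewrite in_itv /= => /andP[b1 b2] fb.
(* [lo] and [hi] are the ends of the rounding interval of .545, and [approx3] is strict, so both
   must be excluded. *)
have {b1} : lo < bbar.
  by rewrite lt_neqAle b1 andbT; apply: contraTneq flo => ->; rewrite fb ltxx.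
have {b2} : bbar < hi.
  by rewrite lt_neqAle b2 andbT; apply: contraTneq fhi => <-; rewrite fb ltxx.
rewrite /lo /hi => {flo fhi lohi} b2 b1.
exists bbar; split.
- by rewrite in_itv /=; apply/andP; split; clear fb; lra.
- by apply: approx3I; apply/andP; split; clear fb; lra.
- move=> b; rewrite in_itv /= => /andP[_ /limit_position_sub_id_le].
  by rewrite -/(f _) fb subr_ge0.
- move=> b; rewrite in_itv /= => /andP[/limit_position_sub_id_le + _].
  by rewrite -/(f bbar) fb subr_le0.
Qed.

Lemma limit_position_integral (R : realType) :
  (\int[lebesgue_measure]_(b in `[0%R, 1%R]%classic)
     (limit_position b)%:E = (1 / 2 : R)%:E)%E.
Proof.
(* An antiderivative, with [F 1 = - (e + 1) / 2] and [F 0 = - e / 2 - 1]. *)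
pose F (b : R) := expR 1 / 2 * b ^+ 2 - 1 / 2 * expR (1 - b) - expR b.
have dF (b : R) : is_derive b 1 F (limit_position b).
  rewrite /F; apply: is_derive_eq.
  rewrite /limit_position /GRing.scale /= !mulr1.
  by field.
have cF (b : R) : {for b, continuous F}.
  by apply: differentiable_continuous; apply/derivable1_diffP; exact: ex_derive.
rewrite (@continuous_FTC2 R _ F)//.
- rewrite -EFinB; congr EFin.
  by rewrite /F expr1n expr0n/= subrr subr0 expR0; field.
- exact: limit_position_continuous.
- split; first by move=> x _; exact: ex_derive.
  + by apply: cvg_at_right_filter; exact: cF.
  + by apply: cvg_at_left_filter; exact: cF.
- by move=> x _; rewrite derive1E; exact: derive_val.
Qed.

(** Since [expR (1 - b) * expR b = e], the left side is a quadratic in [expR b]. Its larger root [y]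
    will be the exponential of the maximum point. *)
Lemma limit_position_deriv_factor (R : realType) :
  exists y : R,
    [/\ 2 + 5 / 100 + 77 / 100 ^+ 2 + 90 / 100 ^+ 3 <= y,
        y <= 2 + 5 / 100 + 78 / 100 ^+ 2 + 20 / 100 ^+ 3,
        y * (expR 1 - y) = expR 1 / 2 &
        forall b, limit_position_deriv b * expR b =
          (y - expR b) * (expR b - (expR 1 - y))].
Proof.
have /andP[e1 e2] := expR1_bounds R.
pose e : R := expR 1; pose r := Num.sqrt (e ^+ 2 - 2 * e).
have r0 : 0 <= r by exact: sqrtr_ge0.
have r2 : r ^+ 2 = e ^+ 2 - 2 * e.
  by rewrite sqr_sqrtr// subr_ge0 expr2 ler_pM2r /e; lra.
rewrite -/e in e1 e2 *.
have yE : (e + r) / 2 * (e - (e + r) / 2) = e / 2.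
  by transitivity ((e ^+ 2 - r ^+ 2) / 4); [field|rewrite r2; field].
exists ((e + r) / 2); split=> //.
(* A bound on [y] is a comparison of [r] with [t], twice the bound minus [e]; it is decided on
   squares because [r ^+ 2] is explicit. *)
- rewrite leNgt; apply/negP => h.
  pose t := 2 * (2 + 5 / 100 + 77 / 100 ^+ 2 + 90 / 100 ^+ 3) - e.
  have : 0 < (t - r) * (t + r) by apply: mulr_gt0; rewrite /t; lra.
  have -> : (t - r) * (t + r) = t ^+ 2 - r ^+ 2 by ring.
  by rewrite r2 /t; nra.
- rewrite leNgt; apply/negP => h.
  pose t := 2 * (2 + 5 / 100 + 78 / 100 ^+ 2 + 20 / 100 ^+ 3) - e.
  have : 0 < (r - t) * (r + t) by apply: mulr_gt0; rewrite /t; lra.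
  have -> : (r - t) * (r + t) = r ^+ 2 - t ^+ 2 by ring.
  by rewrite r2 /t; nra.
- move=> b; rewrite /limit_position_deriv -/e.
  have -> : (e - 1 / 2 * expR (1 - b) - expR b) * expR b =
      e * expR b - 1 / 2 * (expR (1 - b) * expR b) - expR b ^+ 2 by ring.
  rewrite expR_1B -/e.
  have -> : ((e + r) / 2 - expR b) * (expR b - (e - (e + r) / 2)) =
     e * expR b - (e + r) / 2 * (e - (e + r) / 2) - expR b ^+ 2 by field.
  by rewrite yE; field.
Qed.

(** * Location of the maximum and assembly of the properties *)

Theorem corollary2 (R : realType) :
  exists E : R -> R,
    is_limiting_position E /\
    (forall b : R, b \in `[0, 1] ->
       E b = expR 1 * b + 1 / 2 * expR (1 - b) - expR b) /\
    (E 0 = 1 / 2 * expR 1 - 1 /\ approx3 (E 0) 359) /\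
    E 1 = 1 / 2 /\
    (exists bstar : R,
       [/\ bstar \in `[0, 1],
           (forall b : R, b \in `[0, 1] ->
              (expR 1 - expR b - 1 / 2 * expR (1 - b) = 0 <-> b = bstar)),
           approx3 bstar 722,
           {in `[0, bstar] &, {homo E : x y / x < y}} &
           {in `[bstar, 1] &, {homo E : x y / x < y >-> y < x}}] /\
       (forall b : R, b \in `[0, 1] -> E b <= E bstar) /\
       approx3 (E bstar) 564) /\
    (exists bbar : R,
       [/\ bbar \in `[0, 1],
           approx3 bbar 545,
           (forall b : R, b \in `[0, bbar] -> b <= E b) &
           (forall b : R, b \in `[bbar, 1] -> E b <= b)]) /\
    (\int[lebesgue_measure]_(b in `[0%R, 1%R]%classic) (E b)%:E = (1 / 2)%:E)%E.
Proof.
exists limit_position; split; first exact: limit_position_is_limiting.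
have /andP[e1 e2] := expR1_bounds R.
have E0 : limit_position 0 = 1 / 2 * expR 1 - 1 :> R.
  by rewrite /limit_position mulr0 add0r subr0 expR0.
split=> //; split.
  by split=> //; rewrite E0; apply: approx3I; apply/andP; split; lra.
split; first by rewrite /limit_position subrr expR0; field.
split; last by split; [exact: limit_position_fixpoint|
                       exact: limit_position_integral].
have [y [y1 y2 yE dE]] := limit_position_deriv_factor R.
pose bs := ln y; have ebs : expR bs = y by rewrite lnK// posrE; lra.
(* The enclosure [2.05779 <= y <= 2.05782] lies strictly between the bounds 2.05773 and 2.05784 on
   the exponentials of .7216 and .72166. *)
have bs1 : 72 / 100 + 16 / 100 ^+ 2 < bs.
  by rewrite -ltr_expR ebs; have := expR_7216_le R; lra.
have bs2 : bs < 72 / 100 + 16 / 100 ^+ 2 + 60 / 100 ^+ 3.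
  by rewrite -ltr_expR ebs; have := expR_72166_ge R; lra.
have bs0 : 0 <= bs by clear -bs1; lra.
(* As [e - y < 1 <= expR b], the sign of the derivative is that of [y - expR b]. *)
have p1 (b : R) : 0 <= b -> 0 < expR b - (expR 1 - y).
  by move=> b0; have := expR_ge1Dx b; clear -b0 e1 e2 y1; lra.
(* The mean value point [c] is strictly below [z], so the derivative there is positive even when
   [z = bs]. *)
have inc x z : 0 <= x -> x < z -> z <= bs ->
    limit_position x < limit_position z.
  move=> x0 xz zb; have [c /andP[xc cz] cE] := limit_position_MVT R x z xz.
  have zx : 0 < z - x by rewrite subr_gt0.
  rewrite -subr_gt0 cE (pmulr_lgt0 _ zx).
  rewrite -(pmulr_lgt0 _ (expR_gt0 c)) dE pmulr_lgt0 ?p1 ?(ltW (le_lt_trans x0 xc))//.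
  by rewrite subr_gt0 -ebs ltr_expR (lt_le_trans cz).
have dec x z : bs <= x -> x < z -> limit_position z < limit_position x.
  move=> bx xz; have [c /andP[xc cz] cE] := limit_position_MVT R x z xz.
  have zx : 0 < z - x by rewrite subr_gt0.
  rewrite -subr_lt0 cE (pmulr_llt0 _ zx).
  rewrite -(pmulr_llt0 _ (expR_gt0 c)) dE pmulr_llt0 ?p1 ?(le_trans bs0) ?(ltW (le_lt_trans bx xc))//.
  by rewrite subr_lt0 -ebs ltr_expR (le_lt_trans bx).
exists bs; split; [split|split].
- by rewrite in_itv /= bs0/=; clear -bs2; lra.
- move=> b; rewrite in_itv /= => /andP[b0 b1].
  have -> : expR 1 - expR b - 1 / 2 * expR (1 - b) = limit_position_deriv b.
    by rewrite /limit_position_deriv addrAC.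
  split=> [d0|->]; last first.
    apply: (mulIf (lt0r_neq0 (expR_gt0 bs))).
    by rewrite dE ebs subrr !mul0r.
  apply: expR_inj; rewrite ebs; apply/eqP; rewrite eq_sym -subr_eq0.
  by rewrite -(mulIr_eq0 _ (mulIf (lt0r_neq0 (p1 b b0)))) -dE d0 mul0r.
- by apply: approx3I; apply/andP; split; lra.
- move=> x z; rewrite !in_itv /= => /andP[x0 _] /andP[_ zb] xz.
  exact: inc.
- move=> x z; rewrite !in_itv /= => /andP[bx _] _ xz.
  exact: dec.
- move=> b; rewrite in_itv /= => /andP[b0 b1].
  by have [bb|bb|->] := ltgtP b bs; [exact/ltW/inc|exact/ltW/dec|].
(* By the product of the roots, the maximum value is [e * bs + e - 2 * y]. *)
- have qE : expR (1 - bs) / 2 = expR 1 - y.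
    have y0 : y != 0 by rewrite gt_eqF//; lra.
    by apply: (mulfI y0); rewrite yE -(expR_1B R bs) ebs; field.
  rewrite /limit_position ebs; apply: approx3I.
  (* [m1] and [m2] bound the product [expR 1 * bs] from below and from above by affine expressions,
     as [lra] requires; the second factor here is [bs - .7184]. *)
  have m1 : 0 <= (expR 1 - (2 + 71 / 100 + 82 / 100 ^+ 2 + 80 / 100 ^+ 3)) * (bs - 72 / 100 + 16 / 100 ^+ 2).
    by apply: mulr_ge0; lra.
  have m2 : 0 <= (2 + 71 / 100 + 82 / 100 ^+ 2 + 90 / 100 ^+ 3 - expR 1) * bs.
    by apply: mulr_ge0; lra.
  by apply/andP; split; lra.
Qed.
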